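(* Let $q$ be a prime power of characteristic $p>3$, and let $d\ge1$ satisfy $d\equiv8\pmod p$. Write $Q(x)=x_1^2+\cdots+x_d^2$ on $\mathbb F_q^d$, let $e_1,\ldots,e_d$ be the standard basis, and put $\mathbf 1=(1,\ldots,1)$. Then $$X_d=\left\{\tfrac12\mathbf 1+e_i+e_j:1\le i<j\le d\right\}\cup\left\{\tfrac14\mathbf 1+e_i:1\le i\le d\right\}\cup\left\{\tfrac34\mathbf 1-e_i:1\le i\le d\right\}\cup\{\mathbf 1\}$$ is a two-distance set with squared distances $2$ and $4$, and $$|X_d|=\binom{d+2}{2}.$$
   Context: A set $S\subseteq\mathbb F_q^d$ is a two-distance set if $Q(x-y)$, over distinct $x,y\in S$, takes exactly two values; these values are its squared distances. *)

(* Defs.v *)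
From HB Require Import structures.
From mathcomp Require Import all_boot all_order all_algebra.

Set Implicit Arguments.
Unset Strict Implicit.
Unset Printing Implicit Defensive.

Import GRing.Theory.
Local Open Scope ring_scope.

Section TwoDistance.
Variables (F : finFieldType) (d : nat).
Implicit Types (x y : 'rV[F]_d) (S : {set 'rV[F]_d}).

Definition Q x : F := \sum_(i < d) x 0 i ^+ 2.

Definition squared_distances S : {set F} :=
  [set Q (x - y) | x in S, y in S & x != y].

Definition two_distance_set S : bool := #|squared_distances S| == 2%N.

End TwoDistance.

Section Example.
Variables (F : finFieldType) (d : nat).

Definition std_basis (i : 'I_d) : 'rV[F]_d := delta_mx 0 i.

Definition all_ones : 'rV[F]_d := const_mx 1.

Local Notation e := std_basis.
Local Notation ones := all_ones.

Definition X : {set 'rV[F]_d} :=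
  [set (1 / 2) *: ones + e i + e j | i : 'I_d in 'I_d, j : 'I_d in 'I_d
                                     & (i < j)%N]
  :|: [set (1 / 4) *: ones + e i | i : 'I_d]
  :|: [set (3 / 4) *: ones - e i | i : 'I_d]
  :|: [set ones].

End Example.

(* Main.v *)
Require Import Defs.
From HB Require Import structures.
From mathcomp Require Import all_boot all_order all_algebra.
From mathcomp Require Import ring zify.

(** Since [d = 8] in [F], the inner product of [a 1 + u] and [b 1 + v] is
    [8 a b + a (sum v) + b (sum u) + u.v].  Evaluating this on every pair of
    differently labelled points of [X] gives squared distance 2 or 4, both
    nonzero in characteristic [p > 3].  Hence distinct labels give distinct
    points, so [|X| = 'C(d, 2) + d + d + 1]. *)

Set Implicit Arguments.
Unset Strict Implicit.
Unset Printing Implicit Defensive.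

Import GRing.Theory.
Local Open Scope ring_scope.

(** * The symmetric bilinear form attached to [Q] *)

Section Dot.
Variables (F : finFieldType) (d : nat).
Implicit Types (x y z : 'rV[F]_d) (i j : 'I_d).

Definition dot x y : F := \sum_(i < d) x 0 i * y 0 i.

Lemma dotC x y : dot x y = dot y x.
Proof. by apply: eq_bigr => i _; rewrite mulrC. Qed.

Lemma dotDl x y z : dot (x + y) z = dot x z + dot y z.
Proof. by rewrite -big_split; apply: eq_bigr => i _; rewrite mxE mulrDl. Qed.

Lemma dotZl a x z : dot (a *: x) z = a * dot x z.
Proof. by rewrite mulr_sumr; apply: eq_bigr => i _; rewrite mxE mulrA. Qed.

Lemma dotNl x z : dot (- x) z = - dot x z.
Proof. by rewrite -scaleN1r dotZl mulN1r. Qed.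

Lemma dotDr x y z : dot z (x + y) = dot z x + dot z y.
Proof. by rewrite dotC dotDl !(dotC z). Qed.

Lemma dotZr a x z : dot z (a *: x) = a * dot z x.
Proof. by rewrite dotC dotZl (dotC z). Qed.

Lemma dotNr x z : dot z (- x) = - dot z x.
Proof. by rewrite dotC dotNl (dotC z). Qed.

Lemma dot_basisr x i : dot x (std_basis F i) = x 0 i.
Proof.
rewrite /dot (bigD1 i) //= big1 => [|j ji]; rewrite mxE !eqxx ?mulr1 ?addr0 //.
by rewrite (negPf ji) mulr0.
Qed.

Lemma dot_basis i j : dot (std_basis F i) (std_basis F j) = (i == j)%:R.
Proof. by rewrite dot_basisr mxE eqxx eq_sym. Qed.

Lemma dot_ones_basis i : dot (all_ones F d) (std_basis F i) = 1.
Proof. by rewrite dot_basisr mxE. Qed.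

Lemma dot_basis_ones i : dot (std_basis F i) (all_ones F d) = 1.
Proof. by rewrite dotC dot_ones_basis. Qed.

Lemma dot_ones : dot (all_ones F d) (all_ones F d) = d%:R.
Proof.
rewrite /dot (eq_bigr (fun=> 1)) ?sumr_const ?card_ord // => i _.
by rewrite mxE mulr1.
Qed.

Lemma Q_dot x : Q x = dot x x.
Proof. by apply: eq_bigr => i _; rewrite expr2. Qed.

(** Polarisation: every squared distance is read off from three Gram entries. *)
Lemma QB x y : Q (x - y) = dot x x + dot y y - dot x y *+ 2.
Proof. by rewrite Q_dot dotDl !dotDr !dotNl !dotNr (dotC y x); ring. Qed.

Lemma Q0 : Q (0 : 'rV[F]_d) = 0.
Proof. by rewrite Q_dot -(scale0r 0) dotZl mul0r. Qed.

Lemma QN x : Q (- x) = Q x.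
Proof. by rewrite !Q_dot dotNl dotNr opprK. Qed.

End Dot.

Definition dotE :=
  (dotDl, dotDr, dotNl, dotNr, dotZl, dotZr,
   dot_basis, dot_ones_basis, dot_basis_ones, dot_ones).

(** * Labels for the four families of points, and their number *)

Definition label d := ('I_d * 'I_d + 'I_d + 'I_d + unit)%type.

(** The type [label] admits all pairs of indices, which keeps it a plain sum of finite types; this
    predicate selects one ordering of each two-element subset. *)
Definition is_label d (l : label d) : bool :=
  if l is inl (inl (inl (i, j))) then (i < j)%N else true.

Definition labels d : {set 'I_d * 'I_d + 'I_d + 'I_d + unit} := [set l | is_label l].

(** Grouping by the larger index [j] leaves [j] choices for the smaller one, and the sum of all
    [j < d] is triangular. *)
Lemma card_ltn_pairs d : #|[set ij : 'I_d * 'I_d | (ij.1 < ij.2)%N]| = 'C(d, 2).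
Proof.
rewrite -sum1dep_card -(pair_big_dep xpredT (fun i j : 'I_d => (i < j)%N) (fun _ _ => 1%N)) /=.
rewrite (exchange_big_dep xpredT) //= -triangular_sum big_mkord; apply: eq_bigr => j _.
rewrite (big_ord_narrow (ltnW (ltn_ord j)) (F := fun=> 1%N)).
by rewrite sum1_card card_ord.
Qed.

Lemma card_labels d : #|labels d| = 'C(d + 2, 2).
Proof.
have -> : #|labels d| = ('C(d, 2) + d + d + 1)%N.
  rewrite -sum1_card !big_sumType -card_ltn_pairs.
  congr (_ + _ + _ + _)%N; last 3 first.
  - by under eq_bigl do rewrite inE; rewrite sum1_card card_ord.
  - by under eq_bigl do rewrite inE; rewrite sum1_card card_ord.
  - by under eq_bigl do rewrite inE; rewrite sum1_card card_unit.
  by rewrite -sum1_card; apply: eq_bigl => -[i j]; rewrite !inE.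
(* Pascal's rule, applied repeatedly, peels [d + d + 1] off ['C(d + 2, 2)]. *)
by rewrite addn2 !binS !bin0 !bin1; lia.
Qed.

Lemma pair_mem_le1 d (i j k : 'I_d) : (i < j)%N -> ((i == k) + (j == k) <= 1)%N.
Proof. by rewrite -!val_eqE /=; lia. Qed.

(** The sum counts the common elements of two distinct two-element subsets; the orderings exclude
    the same subset listed in reverse. *)
Lemma overlap_le1 d (i j k l : 'I_d) : (i < j)%N -> (k < l)%N -> (i, j) != (k, l) ->
  ((i == k) + (i == l) + (j == k) + (j == l) <= 1)%N.
Proof. by rewrite xpair_eqE -!val_eqE /=; lia. Qed.

(** * The points, their Gram matrix and their distances *)

Section Points.
Variables (F : finFieldType) (d : nat).

Local Notation e := (@std_basis F d).
Local Notation ones := (all_ones F d).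

Definition pt_pair i j := (1 / 2) *: ones + e i + e j.
Definition pt_quarter i := (1 / 4) *: ones + e i.
Definition pt_three_quarters i := (3 / 4) *: ones - e i.

Definition point (l : label d) : 'rV[F]_d :=
  match l with
  | inl (inl (inl (i, j))) => pt_pair i j
  | inl (inl (inr i)) => pt_quarter i
  | inl (inr i) => pt_three_quarters i
  | inr tt => ones
  end.

(** With the union written as a single image, counting [X] reduces to injectivity of [point] on
    [labels d]. *)
Lemma X_image : X F d = point @: labels d.
Proof.
apply/setP=> x; rewrite !inE; apply/idP/imsetP.
- case/orP=> [/orP[/orP[]|]|].
  + case/imset2P=> i j _; rewrite inE => /andP[_ ij] ->.
    by exists (inl (inl (inl (i, j)))); rewrite ?inE.
  + by case/imsetP=> i _ ->; exists (inl (inl (inr i))); rewrite ?inE.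
  + by case/imsetP=> i _ ->; exists (inl (inr i)); rewrite ?inE.
  + by move/eqP->; exists (inr tt); rewrite ?inE.
- case=> -[[[[i j]|i]|i]|[]]; rewrite inE => lt_ij -> /=.
  + by do 3![apply/orP; left]; apply/imset2P; exists i j; rewrite ?inE.
  + by do 2![apply/orP; left]; apply/orP; right; apply/imsetP; exists i.
  + by apply/orP; left; apply/orP; right; apply/imsetP; exists i.
  + by rewrite eqxx ?orbT.
Qed.

Hypotheses (d8 : d%:R = 8 :> F) (nz2 : 2 != 0 :> F).

Lemma four_neq0 : 4 != 0 :> F.
Proof. by rewrite (natrM F 2 2) mulf_neq0. Qed.

(** The constant is [8 * (1/4) + (1/2) * 2 + (1/2) * 2]; the Booleans come from the products of
    basis vectors. *)
Lemma dot_pair_pair i j k l : dot (pt_pair i j) (pt_pair k l) =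
  4 + ((i == k) + (i == l) + (j == k) + (j == l))%:R.
Proof. by rewrite !dotE d8 !natrD; field; rewrite nz2. Qed.

Lemma dot_pair_quarter i j k :
  dot (pt_pair i j) (pt_quarter k) = 2 + ((i == k) + (j == k))%:R.
Proof. by rewrite !dotE d8 !natrD; field; rewrite nz2 four_neq0. Qed.

Lemma dot_pair_three_quarters i j k :
  dot (pt_pair i j) (pt_three_quarters k) = 4 - ((i == k) + (j == k))%:R.
Proof. by rewrite !dotE d8 !natrD; field; rewrite nz2 four_neq0. Qed.

Lemma dot_pair_ones i j : dot (pt_pair i j) ones = 6.
Proof. by rewrite !dotE d8; field; rewrite nz2. Qed.

Lemma dot_quarter_quarter i k :
  dot (pt_quarter i) (pt_quarter k) = 1 + (i == k)%:R.
Proof. by rewrite !dotE d8; field; rewrite four_neq0. Qed.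

Lemma dot_quarter_three_quarters i k :
  dot (pt_quarter i) (pt_three_quarters k) = 2 - (i == k)%:R.
Proof. by rewrite !dotE d8; field; rewrite four_neq0. Qed.

Lemma dot_quarter_ones i : dot (pt_quarter i) ones = 3.
Proof. by rewrite !dotE d8; field; rewrite four_neq0. Qed.

Lemma dot_three_quarters i k :
  dot (pt_three_quarters i) (pt_three_quarters k) = 3 + (i == k)%:R.
Proof. by rewrite !dotE d8; field; rewrite four_neq0. Qed.

Lemma dot_three_quarters_ones i : dot (pt_three_quarters i) ones = 5.
Proof. by rewrite !dotE d8; field; rewrite four_neq0. Qed.

Definition gramE :=
  (dot_pair_pair, dot_pair_quarter, dot_pair_three_quarters, dot_pair_ones,
   dot_quarter_quarter, dot_quarter_three_quarters, dot_quarter_ones,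
   dot_three_quarters, dot_three_quarters_ones).

Lemma dot_pair (i j : 'I_d) : (i < j)%N -> dot (pt_pair i j) (pt_pair i j) = 6.
Proof.
by move=> ij; rewrite gramE !eqxx (eq_sym j) -val_eqE (ltn_eqF ij) /=; ring.
Qed.

(** The four families have squared norms 6, 2, 4 and 8. Subtracting twice the Gram entry leaves 2,
    4, [4 - 2 n] or [2 + 2 n], where [n] counts index coincidences and is at most 1. *)
Lemma Q_point l m : is_label l -> is_label m -> l != m ->
  Q (point l - point m) \in [set 2; 4].
Proof.
(* Ranking the families and using [Q (- x) = Q x] cuts the sixteen pairs of families to ten. *)
pose kind (l : label d) :=
  match l with inl (inl (inl _)) => 0 | inl (inl _) => 1 | inl _ => 2 | _ => 3 end%N.
wlog le_lm : l m / (kind l <= kind m)%N.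
  move=> IH lab_l lab_m; have [le_lm|lt_ml] := leqP (kind l) (kind m); first exact: IH.
  by rewrite eq_sym -QN opprB; apply: IH => //; apply: ltnW.
have in2 (x : F) : x = 2 -> x \in [set 2; 4] by move->; rewrite !inE eqxx.
have in4 (x : F) : x = 4 -> x \in [set 2; 4] by move->; rewrite !inE eqxx orbT.
have in24 (n : nat) (x : F) : (n <= 1)%N -> x = 4 - n%:R *+ 2 -> x \in [set 2; 4].
  by case: n => [|[]] // _ ->; [apply: in4 | apply: in2]; ring.
have in24' (n : nat) (x : F) : (n <= 1)%N -> x = 2 + n%:R *+ 2 -> x \in [set 2; 4].
  by case: n => [|[]] // _ ->; [apply: in2 | apply: in4]; ring.
rewrite QB.
case: l le_lm => [[[[i j]|i]|i]|[]]; case: m => [[[[k l]|k]|k]|[]] //= _;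
  rewrite /is_label => lt_l lt_m neq_lm; rewrite ?(dot_pair lt_l) ?(dot_pair lt_m).
all: rewrite ?gramE ?dot_ones ?d8 ?eqxx /=.
- apply: in24 (overlap_le1 lt_l lt_m _) _; last ring.
  by apply: contraNneq neq_lm => -[-> ->].
- by apply: in24 (pair_mem_le1 k lt_l) _; ring.
- by apply: in24' (pair_mem_le1 k lt_l) _; ring.
- by apply: in2; ring.
- have /negPf-> : i != k by apply: contraNneq neq_lm => ->.
  by apply: in2 => /=; ring.
- by apply: in24' (leq_b1 (i == k)) _; ring.
- by apply: in4; ring.
- have /negPf-> : i != k by apply: contraNneq neq_lm => ->.
  by apply: in2 => /=; ring.
- by apply: in2; ring.
Qed.

Lemma two_neq_four : 2 != 4 :> F.
Proof. by rewrite -subr_eq0 -oppr_eq0 (_ : - (2 - 4) = 2) //; ring. Qed.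

Lemma point_inj : {in labels d &, injective point}.
Proof.
move=> l m; rewrite !inE => l_lab m_lab eq_lm; apply/eqP/negPn/negP => /(Q_point l_lab m_lab).
by rewrite eq_lm subrr Q0 !inE !(eq_sym 0) (negPf nz2) (negPf four_neq0).
Qed.

Lemma card_X : #|X F d| = 'C(d + 2, 2).
Proof. by rewrite X_image (card_in_imset point_inj) card_labels. Qed.

Lemma squared_distances_X : (0 < d)%N -> squared_distances (X F d) = [set 2; 4].
Proof.
have nz4 := four_neq0; have lab (l : label d) : is_label l -> point l \in X F d.
  by rewrite X_image => l_lab; rewrite imset_f ?inE.
move=> d_gt0; pose i := Ordinal d_gt0; apply/eqP; rewrite eqEsubset; apply/andP; split.
  apply/subsetP=> _ /imset2P[x y + + ->]; rewrite X_image.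
  move=> /imsetP[l l_lab ->]; rewrite inE => /andP[/imsetP[m m_lab ->] neq_lm].
  rewrite !inE in l_lab m_lab.
  by apply: Q_point => //; apply: contraNneq neq_lm => ->.
apply/subsetP=> c c24.
(* Both values occur as distances from [ones]. The two points are then distinct, since [c] is
   nonzero while [Q 0 = 0]. *)
suff [l lab_l c_l] : exists2 l, is_label l & c = Q (point l - point (inr tt)).
  rewrite c_l imset2_f ?lab // inE lab //=; apply: contraTneq c24 => eq_l.
  by rewrite c_l eq_l subrr Q0 !inE !(eq_sym 0) (negPf nz2) (negPf nz4).
case/set2P: c24 => ->.
(* From [ones], a three-quarters point gives [4 + 8 - 2 * 5 = 2] and a quarter point gives
   [2 + 8 - 2 * 3 = 4]. *)
- by exists (inl (inr i)); rewrite //= QB !gramE eqxx dot_ones d8 /=; ring.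
- by exists (inl (inl (inr i))); rewrite //= QB !gramE eqxx dot_ones d8 /=; ring.
Qed.

End Points.

Theorem proposition5p1 (F : finFieldType) (p d : nat)
    (hchar : p \in [pchar F]) (hp : (3 < p)%N)
    (hd : (1 <= d)%N) (hdp : d = 8 %[mod p]) :
  [/\ two_distance_set (X F d),
      squared_distances (X F d) = [set 2; 4]
    & #|X F d| = 'C(d + 2, 2)].
Proof.
have d8 : d%:R = 8 :> F.
  by rewrite -(GRing.natr_mod_pchar hchar) hdp (GRing.natr_mod_pchar hchar).
(* If 2 vanished in [F], then [p] would divide 2, against [3 < p]. *)
have nz2 : 2 != 0 :> F.
  by rewrite -(dvdn_pcharf hchar); apply/negP => /dvdn_leq; lia.
have sqd := squared_distances_X d8 nz2 hd.
split=> //; last exact: card_X.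
by rewrite /two_distance_set sqd cards2 two_neq_four.
Qed.
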